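(* Let $r\ge 1$ be an integer. Then \[ \sum_{P} x^{\mathrm{slr}(P)}\, z^{|P|} \;=\; z^r\, x\, C(r)\prod_{h=1}^{r-1}\bigl(1+x(A(h)-1)\bigr), \] where the sum runs over all Dyck paths $P$ of height exactly $r$, $|P|$ denotes the length (number of steps) of $P$, and $\mathrm{slr}(P)$ is the number of strict left to right maxima of $P$.
   Context: A Dyck path of semi-length $n$ is a lattice path from $(0,0)$ to $(2n,0)$ consisting of $n$ up steps $u=(1,1)$ and $n$ down steps $d=(1,-1)$ that never goes below the $x$-axis; its length is $2n$ and its height is the maximal $y$-coordinate attained. A peak is an occurrence of an up step immediately followed by a down step; its height is the height of its top point. A strict left to right maximum is a peak whose height is strictly greater than the heights of all peaks (equivalently, all points) to its left. Put $\lambda_1=\frac{1+\sqrt{1-4z^2}}{2}$, $\lambda_2=\frac{1-\sqrt{1-4z^2}}{2}$, and for integers $h\ge 0$ \[ C(h)=\frac{z^h\sqrt{1-4z^2}}{\lambda_1^{h+2}-\lambda_2^{h+2}},\qquad A(h)=\frac{\lambda_1^{h+1}-\lambda_2^{h+1}}{\lambda_1^{h+2}-\lambda_2^{h+2}}, \] regarded as power series in $z$ (here $A(h)$ is the generating function, by length, of Dyck paths of height at most $h$, and $C(h)$ that of paths with up and down steps staying in $0\le y\le h$, starting at $0$ and ending at height $h$). The identity is one of formal power series in $z$ with coefficients polynomial in $x$. *)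

(* Defs.v *)
From HB Require Import structures.
From mathcomp Require Import all_boot all_order all_algebra.
From mathcomp Require Import boolp.

Set Implicit Arguments.
Unset Strict Implicit.
Unset Printing Implicit Defensive.

Import Order.TTheory GRing.Theory Num.Theory.
Local Open Scope ring_scope.

(* Formal power series, given by their coefficient sequences; a record, so  *)
(* that the Cauchy product does not clash with the pointwise ring structure *)
(* on functions.                                                            *)

Record fps (R : Type) := Fps { fcoef :> nat -> R }.

Lemma fpsP (R : Type) (f g : fps R) : (forall n, f n = g n) <-> f = g.
Proof.
split=> [|-> //]; case: f g => f [g] /= fg.
by congr Fps; apply/funext.
Qed.

HB.instance Definition _ (R : Type) := gen_eqMixin (fps R).
HB.instance Definition _ (R : Type) := gen_choiceMixin (fps R).

Definition fps_const (R : nmodType) (a : R) : fps R :=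
  Fps (fun n => if n == 0%N then a else 0).

Definition fps_opp (R : zmodType) (f : fps R) : fps R := Fps (fun n => - f n).

Definition fps_add (R : zmodType) (f g : fps R) : fps R :=
  Fps (fun n => f n + g n).

Definition fps_mul (R : pzRingType) (f g : fps R) : fps R :=
  Fps (fun n => \sum_(i < n.+1) f i * g (n - i)%N).

Lemma fps_addA (R : zmodType) : associative (@fps_add R).
Proof. by move=> f g h; apply/fpsP=> n /=; rewrite addrA. Qed.

Lemma fps_addC (R : zmodType) : commutative (@fps_add R).
Proof. by move=> f g; apply/fpsP=> n /=; rewrite addrC. Qed.

Lemma fps_add0 (R : zmodType) : left_id (fps_const 0) (@fps_add R).
Proof. by move=> f; apply/fpsP=> n /=; rewrite if_same add0r. Qed.

Lemma fps_addN (R : zmodType) :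
  left_inverse (fps_const 0) (@fps_opp R) (@fps_add R).
Proof. by move=> f; apply/fpsP=> n /=; rewrite if_same addNr. Qed.

HB.instance Definition _ (R : zmodType) :=
  GRing.isZmodule.Build (fps R)
    (@fps_addA R) (@fps_addC R) (@fps_add0 R) (@fps_addN R).

Definition fps_trunc (R : nzRingType) (N : nat) (f : fps R) : {poly R} :=
  \poly_(i < N) f i.

Lemma fps_mul_trunc (R : nzRingType) (N n : nat) (f g : fps R) :
  (n < N)%N -> fps_mul f g n = (fps_trunc N f * fps_trunc N g)`_n.
Proof.
move=> ltnN; rewrite coefM /=; apply: eq_bigr => i _; rewrite !coef_poly.
have leiN : (i < N)%N by apply: leq_ltn_trans ltnN; rewrite -ltnS.
by rewrite leiN (leq_ltn_trans (leq_subr _ _) ltnN).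
Qed.

Lemma fps_mulC (R : comNzRingType) : commutative (@fps_mul R).
Proof.
move=> f g; apply/fpsP=> n.
by rewrite !(fps_mul_trunc _ _ (ltnSn n)) mulrC.
Qed.

Lemma fps_mulA (R : comNzRingType) : associative (@fps_mul R).
Proof.
move=> f g h; apply/fpsP=> n; pose t := @fps_trunc R n.+1.
have tE k (u : fps R) : (k < n.+1)%N -> (t u)`_k = u k.
  by move=> ltk; rewrite coef_poly ltk.
transitivity ((t f * (t g * t h))`_n).
  rewrite (fps_mul_trunc _ _ (ltnSn n)) !coefM.
  apply: eq_bigr => i _; congr (_ * _).
  have lti : (n - i < n.+1)%N by rewrite ltnS leq_subr.
  by rewrite -/t tE // (fps_mul_trunc _ _ lti).
rewrite mulrA (fps_mul_trunc _ _ (ltnSn n)) !coefM.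
apply: eq_bigr => i _; congr (_ * _).
by rewrite -/t tE // (fps_mul_trunc _ _ (ltn_ord i)).
Qed.

Lemma fps_mul1 (R : nzRingType) : left_id (fps_const 1) (@fps_mul R).
Proof.
move=> f; apply/fpsP=> n /=; rewrite big_ord_recl /= subn0 mul1r.
by rewrite big1 ?addr0 // => i _; rewrite mul0r.
Qed.

Lemma fps_mulDl (R : nzRingType) : left_distributive (@fps_mul R) +%R.
Proof.
move=> f g h; apply/fpsP=> n /=; rewrite -big_split /=.
by apply: eq_bigr => i _; rewrite mulrDl.
Qed.

Lemma fps_1_neq0 (R : nzRingType) : fps_const (1 : R) != 0.
Proof.
by apply/eqP=> /fpsP /(_ 0%N) /eqP; rewrite oner_eq0.
Qed.

HB.instance Definition _ (R : comNzRingType) :=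
  GRing.Zmodule_isComNzRing.Build (fps R) (@fps_mulA R) (@fps_mulC R)
    (@fps_mul1 R) (@fps_mulDl R) (@fps_1_neq0 R).

(* The sequence g determined by g n = F [:: g 0; ...; g n.-1]. *)
Fixpoint course (T : Type) (F : seq T -> T) (n : nat) : seq T :=
  if n is m.+1 then rcons (course F m) (F (course F m)) else [::].

Definition course_rec (T : Type) (F : seq T -> T) (n : nat) : T :=
  F (course F n).

Lemma courseE (T : Type) (F : seq T -> T) (n : nat) :
  course F n = mkseq (course_rec F) n.
Proof. by elim: n => // n IHn; rewrite mkseqS -IHn. Qed.

Lemma course_recE (T : Type) (F : seq T -> T) (n : nat) :
  course_rec F n = F (mkseq (course_rec F) n).
Proof. by rewrite -courseE. Qed.

Definition fps_unit (R : comUnitRingType) : {pred fps R} :=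
  fun f => f 0%N \is a GRing.unit.

Definition fps_recip (R : comUnitRingType) (f : fps R) : fps R :=
  Fps (course_rec (fun s => (f 0%N)^-1 *
    ((size s == 0%N)%:R - \sum_(i < size s) s`_i * f (size s - i)%N))).

Definition fps_inv (R : comUnitRingType) (f : fps R) : fps R :=
  if f \in @fps_unit R then fps_recip f else f.

Lemma fps_mulVf (R : comUnitRingType) :
  {in @fps_unit R, left_inverse 1 (@fps_inv R) *%R}.
Proof.
move=> f fU; rewrite /fps_inv fU; apply/fpsP=> n.
have f0U : f 0%N \is a GRing.unit by [].
transitivity (\sum_(i < n.+1) fps_recip f i * f (n - i)%N) => //.
rewrite big_ord_recr /= subnn [X in _ + X * _]course_recE size_mkseq.
rewrite [X in _ + X]mulrC mulVKr //.
rewrite [X in _ + (_ - X)](_ : _ =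
    \sum_(i < n) fps_recip f i * f (n - i)%N); last first.
  by apply: eq_bigr => i _; rewrite nth_mkseq.
by rewrite addrC subrK /=; case: eqP.
Qed.

Lemma fps_unitPl (R : comUnitRingType) (f g : fps R) :
  g * f = 1 -> fps_unit f.
Proof.
move=> /fpsP /(_ 0%N) /=; rewrite big_ord_recl big_ord0 addr0 /= => gf1.
by apply/unitrP; exists (g 0%N); rewrite gf1 mulrC gf1.
Qed.

Lemma fps_invr_out (R : comUnitRingType) :
  {in [predC @fps_unit R], @fps_inv R =1 id}.
Proof. by move=> f; rewrite inE /= /fps_inv => /negbTE ->. Qed.

HB.instance Definition _ (R : comUnitRingType) :=
  GRing.ComNzRing_hasMulInverse.Build (fps R)
    (@fps_mulVf R) (@fps_unitPl R) (@fps_invr_out R).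

Lemma fps_unitE (R : comUnitRingType) (f : fps R) :
  (f \is a GRing.unit) = (f 0%N \is a GRing.unit).
Proof. by []. Qed.

(* For f with constant coefficient 1 and 2 invertible: the square root of f *)
(* with constant coefficient 1 (see fps_sqrtK).                             *)
Definition fps_sqrt (R : comUnitRingType) (f : fps R) : fps R :=
  Fps (course_rec (fun s => if size s == 0%N then 1 else
    (f (size s) - \sum_(1 <= i < size s) s`_i * s`_(size s - i)) / 2%:R)).

Lemma fps_sqrt0 (R : comUnitRingType) (f : fps R) : fps_sqrt f 0%N = 1.
Proof. by []. Qed.

Lemma fps_sqrtK (R : comUnitRingType) (f : fps R) :
  2%:R \is a @GRing.unit R -> f 0%N = 1 -> fps_sqrt f ^+ 2 = f.
Proof.
move=> U2 f0; apply/fpsP=> -[|n].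
  by rewrite /= big_ord_recl big_ord0 addr0 /= mulr1 f0.
have gE : fps_sqrt f n.+1 =
    (f n.+1 - \sum_(i < n) fps_sqrt f i.+1 * fps_sqrt f (n - i)%N) / 2%:R.
  rewrite [LHS]course_recE; cbv beta.
  rewrite size_mkseq (_ : (n.+1 == 0%N) = false) //; cbv iota.
  rewrite big_add1 big_mkord.
  congr ((_ - _) / _); apply: eq_bigr => i _.
  by rewrite subSS !nth_mkseq ?ltnS ?leq_subr ?ltn_ord.
move: gE (fps_sqrt0 f); move: (fps_sqrt f) => g gE g0.
transitivity (\sum_(i < n.+2) g i * g (n.+1 - i)%N) => //.
rewrite big_ord_recr big_ord_recl /= subnn subn0 g0 mul1r mulr1.
by rewrite addrAC -mulr2n gE -[_ *+ 2]mulr_natr mulrVK // subrK.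
Qed.

Notation Qxz := (fps {poly rat}).

Definition zvar : Qxz := Fps (fun n => (n == 1%N)%:R).
Definition xvar : Qxz := fps_const 'X.

Definition sqrtD : Qxz := fps_sqrt (1 - 4%:R * zvar ^+ 2).

Definition lambda1 : Qxz := (1 + sqrtD) / 2%:R.
Definition lambda2 : Qxz := (1 - sqrtD) / 2%:R.

Definition C (h : nat) : Qxz :=
  zvar ^+ h * sqrtD / (lambda1 ^+ (h + 2) - lambda2 ^+ (h + 2)).

Definition A (h : nat) : Qxz :=
  (lambda1 ^+ (h + 1) - lambda2 ^+ (h + 1)) /
  (lambda1 ^+ (h + 2) - lambda2 ^+ (h + 2)).

(* Inversion is total in MathComp (it is the identity on non-units); the    *)
(* next lemmas show that every inverse and root above is a genuine one.     *)
Lemma fps_coef0M (R : comNzRingType) (f g : fps R) :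
  (f * g) 0%N = f 0%N * g 0%N.
Proof. by rewrite /= big_ord_recl big_ord0 addr0. Qed.

Lemma fps_coef0X (R : comNzRingType) (f : fps R) (n : nat) :
  (f ^+ n) 0%N = f 0%N ^+ n.
Proof. by elim: n => // n IHn; rewrite !exprS fps_coef0M IHn. Qed.

Lemma unit2_polyrat : 2%:R \is a @GRing.unit {poly rat}.
Proof. by rewrite -polyC_natr rmorph_unit. Qed.

Lemma unit2_Qxz : 2%:R \is a @GRing.unit Qxz.
Proof. by rewrite fps_unitE; exact: unit2_polyrat. Qed.

Lemma sqrtD_sqr : sqrtD ^+ 2 = 1 - 4%:R * zvar ^+ 2.
Proof.
apply: fps_sqrtK; first exact: unit2_polyrat.
transitivity (1 - (4%:R * zvar ^+ 2) 0%N : {poly rat}) => //.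
by rewrite fps_coef0M fps_coef0X expr0n mulr0 subr0.
Qed.

Lemma lambda_sum : lambda1 + lambda2 = 1.
Proof.
rewrite /lambda1 /lambda2 -mulrDl addrACA subrr addr0.
exact: mulrV unit2_Qxz.
Qed.

Lemma lambda2_coef0 : lambda2 0%N = 0.
Proof.
rewrite fps_coef0M (_ : (1 - sqrtD) 0%N = 0) ?mul0r //.
by rewrite -[LHS]/(1 - 1 : {poly rat}) subrr.
Qed.

Lemma lambda1_coef0 : lambda1 0%N = 1.
Proof.
have /fpsP/(_ 0%N) := lambda_sum.
by rewrite -[LHS]/(lambda1 0%N + lambda2 0%N) lambda2_coef0 addr0.
Qed.

Lemma lambda_den_unit (h : nat) :
  lambda1 ^+ (h + 2) - lambda2 ^+ (h + 2) \is a GRing.unit.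
Proof.
rewrite fps_unitE (_ : _ 0%N = 1) ?unitr1 //.
rewrite -[LHS]/((lambda1 ^+ (h + 2)) 0%N - (lambda2 ^+ (h + 2)) 0%N).
rewrite !fps_coef0X lambda1_coef0 lambda2_coef0.
by rewrite expr1n expr0n addn2 subr0.
Qed.

(* Dyck paths, encoded by their step sequences: true is the up step (1,1),  *)
(* false is the down step (1,-1).                                           *)

Definition step (b : bool) : int := if b then 1 else -1.

(* y-coordinate of the point of abscissa k, for k <= size w *)
Definition level (w : seq bool) (k : nat) : int :=
  \sum_(b <- take k w) step b.

Definition dyck (w : seq bool) : bool :=
  [forall k : 'I_(size w).+1, 0 <= level w k] && (level w (size w) == 0).

(* The default value 0 is the ordinate of the starting point. *)
Definition height (w : seq bool) : int :=
  \big[Order.max/0]_(k < (size w).+1) level w k.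

(* The point of abscissa k is the top of a peak: step number k (steps being *)
(* numbered from 1) is up and step number k+1 is down.                      *)
Definition peak (w : seq bool) (k : nat) : bool :=
  [&& (0 < k < size w)%N, nth false w k.-1 & ~~ nth false w k].

Definition strict_lr_max (w : seq bool) (k : nat) : bool :=
  peak w k && [forall j : 'I_k, peak w j ==> (level w j < level w k)].

Definition slr (w : seq bool) : nat :=
  #|[set k : 'I_(size w) | strict_lr_max w k]|.

(* The formal sum of x^slr(P) z^|P| over all Dyck paths P of height r; only *)
(* the finitely many P of length n contribute to the coefficient of z^n.    *)
Definition dyck_slr_gf (r : nat) : Qxz :=
  Fps (fun n => \sum_(w : n.-tuple bool | dyck w && (height w == r%:Z))
                  'X^(slr w)).

(* Main.v *)
(* Reading a path from left to right, its weight only depends on the        *)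
(* current maximum, the current height and whether the last step has just   *)
(* reached a new maximum. The generating functions of the suffixes starting *)
(* in each of these states satisfy a linear system whose right-hand side    *)
(* has a factor z, so the system has at most one solution, and closed forms *)
(* in lambda1 and lambda2 solve it.                                         *)

Require Import Defs.
From mathcomp Require Import all_boot all_order all_algebra.
From mathcomp Require Import ring zify.

Import Order.TTheory GRing.Theory Num.Theory.
Local Open Scope ring_scope.

Set Implicit Arguments.
Unset Strict Implicit.
Unset Printing Implicit Defensive.

(** A strict left to right maximum is exactly a first visit of a level [h] that is followed by a
    down step. For [1 <= h < r], between the first visits of [h] and [h + 1] the path either goes
    straight up or makes a nonempty excursion below [h], which costs [x] and, turned upside down, is
    counted by [A h - 1]; hence the factor [z (1 + x (A h - 1))]. After the first visit of [r] a
    down step is forced, giving [x], and the rest, reversed, is counted by [C r]. The proof does not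
    cut paths: [suffix_weightE] turns the statistic into a weight on states, [suffix_gfE] checks
    that the closed forms satisfy the step-by-step recursion, and [suffix_weight_gf] identifies the
    two. *)

Lemma level0 (w : seq bool) : level w 0 = 0.
Proof. by rewrite /level take0 big_nil. Qed.

Lemma level_rcons (w : seq bool) (c : bool) (k : nat) :
  (k <= size w)%N -> level (rcons w c) k = level w k.
Proof. by move=> kw; rewrite /level -cats1 takel_cat. Qed.

Lemma level_rcons_size (w : seq bool) (c : bool) :
  level (rcons w c) (size w).+1 = level w (size w) + step c.
Proof.
by rewrite /level -(size_rcons w c) !take_size -cats1 big_cat big_seq1.
Qed.

Lemma level_cat (w s : seq bool) (k : nat) :
  (k <= size w)%N -> level (w ++ s) k = level w k.
Proof. by move=> kw; rewrite /level takel_cat. Qed.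

Lemma peak_rcons (w : seq bool) (c : bool) (k : nat) :
  (k < size w)%N -> peak (rcons w c) k = peak w k.
Proof.
move=> kw; rewrite /peak size_rcons !nth_rcons kw ltnS (ltnW kw).
by rewrite (leq_ltn_trans (leq_pred k) kw).
Qed.

Lemma peak_lt_size (w : seq bool) (k : nat) : peak w k -> (k < size w)%N.
Proof. by case/and3P=> /andP[]. Qed.

Lemma strict_lr_maxP (w : seq bool) (k : nat) :
  reflect (peak w k /\
           forall j, (j < k)%N -> peak w j -> level w j < level w k)
          (strict_lr_max w k).
Proof.
apply: (iffP andP) => -[pk ltk]; split=> //.
  by move=> j jk pj; have /forallP/(_ (Ordinal jk))/implyP := ltk; apply.
by apply/forallP=> j; apply/implyP; apply: ltk.
Qed.

Lemma strict_lr_max_rcons (w : seq bool) (c : bool) (k : nat) :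
  (k < size w)%N -> strict_lr_max (rcons w c) k = strict_lr_max w k.
Proof.
move=> kw; have kw' := ltnW kw.
apply/strict_lr_maxP/strict_lr_maxP; rewrite peak_rcons //.
  case=> pk ltk; split=> // j jk; have jw := ltn_trans jk kw.
  have jw' := ltnW jw.
  by move: (ltk j jk); rewrite peak_rcons // !level_rcons.
case=> pk ltk; split=> // j jk; have jw := ltn_trans jk kw.
have jw' := ltnW jw.
by rewrite peak_rcons // !level_rcons //; apply: ltk.
Qed.

Lemma slr_sum (w : seq bool) :
  slr w = (\sum_(0 <= k < size w) strict_lr_max w k)%N.
Proof.
rewrite /slr -sum1_card big_mkord [RHS](eq_bigr
  (fun k : 'I__ => if strict_lr_max w k then 1%N else 0%N)); last first.
  by move=> k _; case: strict_lr_max.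
by rewrite -big_mkcond; apply: eq_bigl => k; rewrite inE.
Qed.

Lemma slr_rcons (w : seq bool) (c : bool) :
  slr (rcons w c) = (slr w + strict_lr_max (rcons w c) (size w))%N.
Proof.
rewrite !slr_sum size_rcons big_nat_recr //=; congr (_ + _)%N.
by apply: eq_big_nat => k /andP[_ kw]; rewrite strict_lr_max_rcons.
Qed.

Lemma height_eq (w : seq bool) (m : int) : 0 <= m ->
  (forall k, (k <= size w)%N -> level w k <= m) ->
  (exists2 k, (k <= size w)%N & level w k = m) -> height w = m.
Proof.
move=> m0 lem [k kw km]; apply/le_anti/andP; split.
  by apply: bigmax_le => // i _; apply: lem; rewrite -ltnS.
rewrite -{1}km.
exact: (le_bigmax_cond _ (fun i : 'I__ => level w i)
          (j := Ordinal (kw : (k < (size w).+1)%N))).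
Qed.

(* A prefix [p] staying at height at least 0 is summarised by its maximum   *)
(* [m], its final height [y], and whether its last step reaches [m] for the *)
(* first time ([b = true]).                                                 *)
Record prefix_state (p : seq bool) (m y : nat) (b : bool) : Prop :=
  PrefixState {
    ps_ge0 : forall k, (k <= size p)%N -> 0 <= level p k;
    ps_end : level p (size p) = y%:Z;
    ps_le : forall k, (k <= size p)%N -> level p k <= m%:Z;
    ps_max : exists2 k, (k <= size p)%N & level p k = m%:Z;
    ps_fresh : b -> [/\ (0 < size p)%N, nth false p (size p).-1, y = m &
      forall k, (k < size p)%N -> level p k < m%:Z];
    ps_stale : ~~ b -> m = 0%N \/ exists2 k, peak p k & level p k = m%:Z }.

(** * States of a prefix *)

Lemma prefix_state_nil : prefix_state [::] 0 0 false.
Proof.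
split=> //; try by move=> k; rewrite leqn0 => /eqP ->; rewrite level0.
- by rewrite level0.
- by exists 0%N; rewrite ?level0.
- by left.
Qed.

Lemma prefix_state_end_le (p : seq bool) (m y : nat) (b : bool) :
  prefix_state p m y b -> (y <= m)%N.
Proof.
by move=> P; have := ps_le P (leqnn _); rewrite (ps_end P) lez_nat.
Qed.

Lemma prefix_state_record (p : seq bool) (m : nat) (b : bool) :
  prefix_state p m m b -> prefix_state (rcons p true) m.+1 m.+1 true.
Proof.
move=> P; have lsz : level (rcons p true) (size p).+1 = m.+1%:Z.
  by rewrite level_rcons_size (ps_end P) /step -addn1 PoszD.
split=> //; rewrite ?size_rcons //.
- move=> k; rewrite leq_eqVlt => /predU1P[-> | ltk]; first by rewrite lsz.
  by rewrite level_rcons //; apply: ps_ge0 P _ _.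
- move=> k; rewrite leq_eqVlt => /predU1P[-> | ltk]; first by rewrite lsz.
  by rewrite level_rcons //; have := ps_le P ltk; lia.
- by exists (size p).+1.
- move=> _; split=> //; first by rewrite nth_rcons ltnn eqxx.
  by move=> k ltk; rewrite level_rcons //; have := ps_le P ltk; lia.
Qed.

Lemma prefix_state_up (p : seq bool) (m y : nat) (b : bool) :
  (y < m)%N -> prefix_state p m y b -> prefix_state (rcons p true) m y.+1 false.
Proof.
move=> ym P; have lsz : level (rcons p true) (size p).+1 = y.+1%:Z.
  by rewrite level_rcons_size (ps_end P) /step -addn1 PoszD.
split=> //; rewrite ?size_rcons //.
- move=> k; rewrite leq_eqVlt => /predU1P[-> | ltk]; first by rewrite lsz.
  by rewrite level_rcons //; apply: ps_ge0 P _ _.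
- move=> k; rewrite leq_eqVlt => /predU1P[-> | ltk]; first by rewrite lsz.
  by rewrite level_rcons //; apply: ps_le P _ _.
- case: (ps_max P) => k kp km; exists k; first exact: leqW.
  by rewrite level_rcons.
- case: b P => P _; first by case: (ps_fresh P isT) => _ _ /eqP; rewrite ltn_eqF.
  case: (ps_stale P isT) => [|[k pk km]]; [by left | right].
  have kp := peak_lt_size pk.
  by exists k; rewrite ?peak_rcons // level_rcons // ltnW.
Qed.

Lemma prefix_state_down (p : seq bool) (m y : nat) (b : bool) :
  prefix_state p m y.+1 b -> prefix_state (rcons p false) m y false.
Proof.
move=> P; have lsz : level (rcons p false) (size p).+1 = y%:Z.
  by rewrite level_rcons_size (ps_end P) /step; lia.
have ym := prefix_state_end_le P.
split=> //; rewrite ?size_rcons //.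
- move=> k; rewrite leq_eqVlt => /predU1P[-> | ltk]; first by rewrite lsz.
  by rewrite level_rcons //; apply: ps_ge0 P _ _.
- move=> k; rewrite leq_eqVlt => /predU1P[-> | ltk]; first by rewrite lsz; lia.
  by rewrite level_rcons //; apply: ps_le P _ _.
- case: (ps_max P) => k kp km; exists k; first exact: leqW.
  by rewrite level_rcons.
(* Going down from a fresh maximum turns it into a peak of height [m], at abscissa [size p]. *)
- move=> _; case: b P => P.
    case: (ps_fresh P isT) => p0 lastp eym _; right; exists (size p).
      rewrite /peak size_rcons p0 ltnSn !nth_rcons ltnn eqxx.
      by rewrite ltn_predL p0 lastp.
    by rewrite level_rcons // (ps_end P) eym.
  case: (ps_stale P isT) => [|[k pk km]]; [by left | right].
  have kp := peak_lt_size pk.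
  by exists k; rewrite ?peak_rcons // level_rcons // ltnW.
Qed.

Lemma slr_rcons_up (p : seq bool) : slr (rcons p true) = slr p.
Proof.
rewrite slr_rcons /strict_lr_max /peak !nth_rcons ltnn eqxx.
by rewrite !andbF addn0.
Qed.

(** The down step can only complete a peak at the end of [p]. If [b] holds, every earlier point is
    lower; otherwise a peak of height [m] already occurred and rules it out. *)
Lemma slr_rcons_down (p : seq bool) (m y : nat) (b : bool) :
  prefix_state p m y.+1 b -> slr (rcons p false) = (slr p + b)%N.
Proof.
move=> P; rewrite slr_rcons; congr (_ + nat_of_bool _)%N.
case: b P => P.
  case: (ps_fresh P isT) => p0 lastp eym ltm; apply/strict_lr_maxP; split.
    by rewrite /peak size_rcons p0 ltnSn !nth_rcons ltnn eqxx ltn_predL p0 lastp.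
  move=> j jp _; have jp' := ltnW jp.
  by rewrite !level_rcons // (ps_end P) eym ltm.
have ym := prefix_state_end_le P.
case: (ps_stale P isT) => [m0 | [k pk km]]; first by rewrite m0 in ym.
have kp := peak_lt_size pk; have kp' := ltnW kp.
apply/negbTE/negP => /strict_lr_maxP[_ /(_ k kp)].
rewrite peak_rcons // !level_rcons // (ps_end P) km => /(_ pk).
by rewrite ltz_nat ltnNge ym.
Qed.

(* The weight of a suffix [w] read from the state [(m, y, b)]: a factor     *)
(* ['X] is paid when a first visit of a new maximum is followed by a down   *)
(* step, which is exactly when it is a strict left to right maximum.        *)
Fixpoint suffix_weight (r m y : nat) (b : bool) (w : seq bool) : {poly rat} :=
  match w with
  | [::] => ((y == 0%N) && (m == r))%:R
  | true :: w' => if y == m then suffix_weight r m.+1 m.+1 true w'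
                  else suffix_weight r m y.+1 false w'
  | false :: w' => if y is y'.+1 then
                     (if b then 'X else 1) * suffix_weight r m y' false w'
                   else 0
  end.

Lemma suffix_weightE (r m y : nat) (b : bool) (p w : seq bool) :
  prefix_state p m y b ->
  (if dyck (p ++ w) && (height (p ++ w) == r%:Z) then 'X^(slr (p ++ w)) else 0)
    = 'X^(slr p) * suffix_weight r m y b w.
Proof.
elim: w p m y b => [|c w IHw] p m y b P.
  rewrite cats0 /=.
  rewrite (height_eq _ (ps_le P) (ps_max P)) //.
  rewrite /dyck (ps_end P) !eqz_nat.
  have -> : [forall k : 'I_(size p).+1, 0 <= level p k].
    by apply/forallP=> k; apply: (ps_ge0 P); rewrite -ltnS.
  by rewrite /=; case: ifP; rewrite ?mulr1 ?mulr0.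
rewrite -cat_rcons; case: c => /=.
  have := prefix_state_end_le P; case: (eqVneq y m) => [eym _ | nym leym].
    rewrite {}eym in P.
    by rewrite (IHw _ _ _ _ (prefix_state_record P)) slr_rcons_up.
  rewrite (IHw _ _ _ _ (prefix_state_up _ P)) ?slr_rcons_up //.
  by rewrite ltn_neqAle nym.
case: y P => [|y] P.
  (* A down step from height 0 leaves the half-plane, so no completion is a Dyck path. *)
  rewrite mulr0 ifF //; apply/negP=> /andP[/andP[/forallP ge0 _] _].
  have sp : (size p < (size (rcons p false ++ w)))%N.
    by rewrite size_cat size_rcons leq_addr.
  have /= := ge0 (Ordinal (sp : ((size p).+1 < (size _).+1)%N)).
  by rewrite level_cat ?size_rcons // level_rcons_size (ps_end P).
rewrite (IHw _ _ _ _ (prefix_state_down P)) (slr_rcons_down P) exprD -mulrA.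
by case: b {P}; rewrite ?expr1.
Qed.

Lemma big_tuple_bool_cons (V : nmodType) (n : nat) (F : seq bool -> V) :
  \sum_(w : n.+1.-tuple bool) F w =
  \sum_(w : n.-tuple bool) F (true :: w) +
  \sum_(w : n.-tuple bool) F (false :: w).
Proof.
rewrite (reindex (fun u : bool * n.-tuple bool => [tuple of u.1 :: u.2])) /=.
  by rewrite -(pair_bigA _ (fun c w => F (c :: tval w))) /= big_bool.
exists (fun w => (thead w, [tuple of behead w])) => [[c w] _ | w _] /=.
  by congr (_, _); apply: val_inj.
by rewrite -tuple_eta.
Qed.

Lemma zvarM_coef0 (f : Qxz) : (zvar * f) 0%N = 0.
Proof. by rewrite fps_coef0M mul0r. Qed.

Lemma zvarM_coefS (f : Qxz) (n : nat) : (zvar * f) n.+1 = f n.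
Proof.
rewrite -[LHS]/(\sum_(i < n.+2) zvar i * f (n.+1 - i)%N).
rewrite 2!big_ord_recl /= mul0r add0r mul1r subSS subn0.
by rewrite big1 ?addr0 // => i _; rewrite mul0r.
Qed.

Lemma fps_coefD (R : zmodType) (f g : fps R) (n : nat) : (f + g) n = f n + g n.
Proof. by []. Qed.

Lemma fps_coef_bool (R : comNzRingType) (b : bool) (n : nat) :
  (b%:R : fps R) n = ((n == 0%N) && b)%:R.
Proof. by case: b n => -[]. Qed.

Lemma xvarM_coef (f : Qxz) (n : nat) : (xvar * f) n = 'X * f n.
Proof.
rewrite -[LHS]/(\sum_(i < n.+1) xvar i * f (n - i)%N).
rewrite big_ord_recl /= subn0.
by rewrite big1 ?addr0 // => i _; rewrite mul0r.
Qed.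

(** * Algebra of the closed forms *)

Lemma sqrtD_unit : sqrtD \is a GRing.unit.
Proof. by rewrite fps_unitE /sqrtD fps_sqrt0 unitr1. Qed.

(* Up to the factor [sqrtD], the polynomials in [zvar ^+ 2] of which [A h]  *)
(* is a quotient.                                                           *)
Definition lucas (k : nat) : Qxz := lambda1 ^+ k - lambda2 ^+ k.

Lemma lambda_prod : lambda1 * lambda2 = zvar ^+ 2.
Proof.
have U2 := unit2_Qxz.
have e1 : 2%:R * lambda1 = 1 + sqrtD by rewrite mulrC divrK.
have e2 : 2%:R * lambda2 = 1 - sqrtD by rewrite mulrC divrK.
have U4 : (2%:R * 2%:R : Qxz) \is a GRing.unit by rewrite unitrM U2.
apply: (mulrI U4); rewrite mulrACA e1 e2.
rewrite (_ : _ * _ = 1 - sqrtD ^+ 2); last by ring.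
by rewrite sqrtD_sqr; ring.
Qed.

Lemma lucas0 : lucas 0 = 0.
Proof. by rewrite /lucas !expr0 subrr. Qed.

Lemma lucas1 : lucas 1 = sqrtD.
Proof.
have U2 := unit2_Qxz; rewrite /lucas !expr1 /lambda1 /lambda2 -mulrBl.
apply: (mulIr U2); rewrite divrK //; ring.
Qed.

(** Both lambdas are roots of [t^2 = t - z^2]. *)
Lemma lucasSS (k : nat) : lucas k.+2 = lucas k.+1 - zvar ^+ 2 * lucas k.
Proof.
have l2 : lambda2 = 1 - lambda1 by rewrite -lambda_sum addrC addKr.
by rewrite /lucas -lambda_prod l2 !exprS; ring.
Qed.

Lemma lucas2 : lucas 2 = sqrtD.
Proof. by rewrite lucasSS lucas0 mulr0 subr0 lucas1. Qed.

Lemma lucasSS_unit (k : nat) : lucas k.+2 \is a GRing.unit.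
Proof. by rewrite -addn2; apply: lambda_den_unit. Qed.

Lemma AE (h : nat) : A h = lucas h.+1 / lucas h.+2.
Proof. by rewrite /A addn1 addn2. Qed.

Lemma CE (h : nat) : C h = zvar ^+ h * sqrtD / lucas h.+2.
Proof. by rewrite /C addn2. Qed.

Lemma A_sub1 (h : nat) : A h - 1 = zvar ^+ 2 * lucas h / lucas h.+2.
Proof.
rewrite AE -(mulrV (lucasSS_unit h)) -mulrBl; congr (_ / _).
by rewrite lucasSS; ring.
Qed.

(* Suffixes starting with the first visit of height [m].                    *)
Definition record_gf (r m : nat) : Qxz :=
  zvar ^+ (r - m) * xvar * C r * \prod_(m <= h < r) (1 + xvar * (A h - 1)).

(* Below the final maximum [r], a suffix starting at height [y] splits at   *)
(* its first visit of height [m.+1]; at [m = r] it is a path from [y] to 0  *)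
(* in the strip of heights from 0 to [r].                                   *)
Definition suffix_gf (r m y : nat) (b : bool) : Qxz :=
  if (r < m)%N then 0
  else if b then record_gf r m
  else if m == r then zvar ^+ y * lucas (r - y).+1 / lucas r.+2
  else zvar ^+ (m.+1 - y) * lucas y.+1 / lucas m.+2 * record_gf r m.+1.

Lemma record_gf_ltn (r m : nat) : (m < r)%N ->
  record_gf r m = zvar * (1 + xvar * (A m - 1)) * record_gf r m.+1.
Proof.
move=> mr; rewrite /record_gf big_ltn // -[(r - m)%N]prednK ?subn_gt0 //.
by rewrite -subnS exprS; ring.
Qed.

(** This is the linear system, one equation per state, split by the first step of the suffix. In
    each case it reduces to the recurrence [lucasSS]. The condition on [b] is there because
    [record_gf] does not see [y]. *)
Lemma suffix_gfE (r m y : nat) (b : bool) :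
  (y <= m)%N -> (b -> (0 < m)%N && (y == m)) ->
  suffix_gf r m y b = ((y == 0%N) && (m == r))%:R +
    zvar * ((if y == m then suffix_gf r m.+1 m.+1 true
             else suffix_gf r m y.+1 false) +
            (if y is y'.+1 then (if b then xvar else 1) * suffix_gf r m y' false
             else 0)).
Proof.
move=> ym vb; rewrite /suffix_gf; case: (ltngtP r m) => [rm | mr | emr].
- rewrite (ltnW rm : (r < m.+1)%N) andbF if_same.
  by case: y {ym vb} => [|y]; rewrite add0r ?mulr0 add0r mulr0.
- rewrite (ltnNge r m.+1) mr andbF /= add0r.
  case: b vb => [/(_ isT)/andP[m0 /eqP ->] | _].
    rewrite eqxx record_gf_ltn // A_sub1; case: m m0 {mr ym} => // m _.
    rewrite (_ : m.+2 - m = 2)%N; last by lia.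
    ring.
  move: ym; rewrite leq_eqVlt => /predU1P[-> | ym].
    rewrite eqxx subSnn expr1; case: m {mr} => [|m].
      by rewrite lucas1 lucas2 addr0 mulrK // sqrtD_unit.
    rewrite (_ : m.+2 - m = 2)%N; last by lia.
    (* Writing 1 as a quotient of equal [lucas] terms puts both sides over one denominator. *)
    rewrite mul1r -[X in _ = _ * (X + _)]mul1r -(mulrV (lucasSS_unit m.+1)).
    rewrite (lucasSS m.+1).
    ring.
  rewrite (ltn_eqF ym); case: y ym => [|y] ym.
    rewrite subn0 subSS subn0 addr0 lucas1 lucas2 exprS.
    ring.
  rewrite !subSS -[(m - y)%N]prednK ?subn_gt0 ?(ltnW ym) // -subnS.
  rewrite (subSn (ltnW (ltnW ym))) -[(m - y)%N]prednK ?subn_gt0 ?(ltnW ym) //.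
  rewrite -subnS (lucasSS y.+1) !exprS.
  ring.
subst m; rewrite ltnSn.
case: b vb => [/(_ isT)/andP[r0 /eqP ->] | _].
  rewrite eqxx (gtn_eqF r0) /record_gf subnn big_geq // CE.
  case: r r0 {ym} => // r _; rewrite subSnn lucas2 expr0 exprS.
  by rewrite add0r; ring.
move: ym; rewrite leq_eqVlt => /predU1P[-> | yr].
  rewrite eqxx subnn lucas1; case: r => [|r].
    by rewrite lucas2 expr0 mul1r mulrV ?sqrtD_unit // !addr0 mulr0 addr0.
  by rewrite add0r subSnn lucas2 exprS; ring.
rewrite (ltn_eqF yr); case: y yr => [|y] yr /=.
  rewrite subn0 expr0 expr1 mul1r addr0 -(mulrV (lucasSS_unit r)).
  case: r yr => // r _; rewrite subSS subn0 mulr1n (lucasSS r.+1).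
  ring.
rewrite add0r -[(r - y)%N]prednK ?subn_gt0 ?(ltnW yr) // -subnS.
rewrite -[(r - y.+1)%N]prednK ?subn_gt0 // -subnS.
rewrite (lucasSS (r - y.+2).+1) !exprS.
ring.
Qed.

(** Uniqueness for the system: because of the factor [zvar], coefficient [n + 1] in one state
    depends only on coefficients [n] in others. *)
Lemma suffix_weight_gf (r m y : nat) (b : bool) (n : nat) :
  (y <= m)%N -> (b -> (0 < m)%N && (y == m)) ->
  \sum_(w : n.-tuple bool) suffix_weight r m y b w = suffix_gf r m y b n.
Proof.
elim: n m y b => [|n IHn] m y b ym vb; rewrite (suffix_gfE _ ym vb).
  rewrite (big_pred1 [tuple]) => [|w]; last by rewrite [w]tuple0 /= eqxx.
  by rewrite fps_coefD fps_coef_bool zvarM_coef0 addr0.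
rewrite big_tuple_bool_cons fps_coefD fps_coef_bool zvarM_coefS add0r fps_coefD.
congr (_ + _) => /=.
  case: (eqVneq y m) ym => [_ _ | nym ym]; first by rewrite -IHn ?eqxx.
  by rewrite -IHn // ltn_neqAle nym.
case: y ym {vb} => [|y] ym; first by rewrite big1 //; case: (n).
rewrite -mulr_sumr IHn ?(ltnW ym) //.
by case: b; rewrite ?xvarM_coef ?mul1r.
Qed.

Theorem theorem1 (r : nat) (hr : (1 <= r)%N) :
  dyck_slr_gf r =
    zvar ^+ r * xvar * C r * \prod_(1 <= h < r) (1 + xvar * (A h - 1)).
Proof.
have -> : dyck_slr_gf r = suffix_gf r 0 0 false.
  apply/fpsP=> n; rewrite -suffix_weight_gf //= big_mkcond /=.
  apply: eq_bigr => w _; rewrite (suffix_weightE r w prefix_state_nil).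
  by rewrite slr_sum big_geq // expr0 mul1r.
(* The first step is forced up to height 1; it supplies one factor [z], and [record_gf r 1] the
   other [r - 1]. *)
rewrite suffix_gfE // (ltn_eqF hr) add0r addr0 /suffix_gf ltnNge hr /=.
rewrite /record_gf; case: r hr => // r _; rewrite subn1 exprS.
ring.
Qed.
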